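(* Let $s$ be a positive integer and let $u_1,\dots,u_s$ be non-commutator words involving pairwise disjoint sets of variables. Then the word $[u_1,\dots,u_s]$ is boundedly concise in profinite groups.
   Context: For a group-word $w=w(x_1,\dots,x_k)$ and a group $G$, $G_w=\{w(g_1,\dots,g_k): g_i\in G\}$ is the set of $w$-values in $G$. For a profinite group $G$, $w(G)$ denotes the minimal closed subgroup of $G$ containing $G_w$. A word $w$ is boundedly concise in profinite groups if for every integer $m$ there exists a number $\nu=\nu(w,m)$ such that whenever $|G_w|\le m$ for a profinite group $G$ it follows that $|w(G)|\le \nu$. A non-commutator word is a word such that the sum of the exponents of some variable involved in it is non-zero. Commutators are $[x,y]=x^{-1}y^{-1}xy$ and are left-normed: $[x_1,\dots,x_s]=[[x_1,\dots,x_{s-1}],x_s]$, with $[x_1]=x_1$. *)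

(* Defs.v *)
From HB Require Import structures.
From mathcomp Require Import all_boot all_order all_algebra.
From mathcomp Require Import boolp classical_sets functions cardinality.
From mathcomp Require Import topology.

Set Implicit Arguments.
Unset Strict Implicit.
Unset Printing Implicit Defensive.

Local Open Scope classical_set_scope.
Local Open Scope card_scope.

(* A letter [(i, false)] stands for x_i and [(i, true)] for x_i^-1.  Words are
   not required to be reduced: neither [weval] nor [exponent_sum] changes under
   free reduction, and reduction can only shrink [wvars]. *)
Definition word := seq (nat * bool).

Definition wvars (w : word) : seq nat := map fst w.

Definition winv (w : word) : word := rev [seq (l.1, ~~ l.2) | l <- w].

Definition wcomm (v w : word) : word := winv v ++ winv w ++ v ++ w.

(* The left-normed commutator; the value on the empty sequence is a dummy. *)
Definition wcomms (us : seq word) : word :=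
  if us is u :: us' then foldl wcomm u us' else [::].

Definition exponent_sum (w : word) (i : nat) : int :=
  (\sum_(l <- w | l.1 == i) (-1) ^+ l.2)%R.

Definition non_commutator (w : word) : Prop :=
  exists2 i, i \in wvars w & exponent_sum w i <> 0%R.

(* The assignment [g] gives a value to every variable, but only its values on
   [wvars w] matter. *)
Definition weval (G : groupType) (g : nat -> G) (w : word) : G :=
  (\prod_(l <- w) (if l.2 then (g l.1)^-1 else g l.1))%g.

Definition wvalues (G : groupType) (w : word) : set G :=
  range (fun g : nat -> G => weval g w).
Arguments wvalues : clear implicits.

HB.mixin Record isTopologicalGroup G of Topological G & Group G := {
  mulg_continuous : continuous (fun p : G * G => (p.1 * p.2)%g);
  invg_continuous : continuous (fun x : G => x^-1%g)
}.

#[short(type="topologicalGroupType")]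
HB.structure Definition TopologicalGroup :=
  {G of Topological G & Group G & isTopologicalGroup G}.

HB.mixin Record isProfinite G of TopologicalGroup G := {
  profinite_compact : compact [set: G];
  profinite_hausdorff : hausdorff_space G;
  profinite_totally_disconnected : totally_disconnected [set: G]
}.

#[short(type="profiniteGroupType")]
HB.structure Definition ProfiniteGroup :=
  {G of TopologicalGroup G & isProfinite G}.

Definition closed_subgroup (G : topologicalGroupType) (H : set G) : Prop :=
  closed H /\ group_closed (mem H).

Definition verbal_subgroup (G : topologicalGroupType) (w : word) : set G :=
  smallest (@closed_subgroup G) (wvalues G w).
Arguments verbal_subgroup : clear implicits.

Definition boundedly_concise (w : word) : Prop :=
  forall m : nat, exists nu : nat, forall G : profiniteGroupType,
    wvalues G w #<= `I_m -> verbal_subgroup G w #<= `I_nu.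

(* Main.v *)
Require Import Defs.
From HB Require Import structures.
From mathcomp Require Import all_boot all_order all_algebra.
From mathcomp Require Import boolp classical_sets functions cardinality.
From mathcomp Require Import generic_quotient topology zify.

Import GRing.Theory.

(* By Dietzmann's lemma it suffices to bound the orders of the w-values, and
   this can be done in arbitrary groups, by induction on s.  For w = [v, u], all
   e-th powers are u-values for some e > 0, so by the pigeonhole principle each
   v-value x commutes with all N-th powers, where N depends only on e and m.
   Let K be the centralizer of the w-values, H the centralizer of K, and T the
   elements of order dividing N in the abelian group H :&: K.  As G / K is
   finite, v takes boundedly many values modulo the subgroup L of those g with
   [g, y] in T for all u-values y, and so x ^+ n lies in L for a bounded n by
   induction.  With c = [x, y], this means that the product of the conjugates
   c ^ (x ^+ j), for j < n, lies in T.  The transfer from H to its central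
   subgroup H :&: K of finite index turns this into a bound on the order of
   c. *)

Set Implicit Arguments.
Unset Strict Implicit.
Unset Printing Implicit Defensive.

Local Open Scope group_scope.
Local Open Scope quotient_scope.

(** * Word values *)

Section Words.
Variable G : groupType.
Implicit Types (g h : nat -> G) (v w : word).

Lemma weval_cat g v w : weval g (v ++ w) = weval g v * weval g w.
Proof. by rewrite /weval big_cat. Qed.

Lemma weval_winv g w : weval g (winv w) = (weval g w)^-1.
Proof.
rewrite /weval /winv -map_rev big_map -[in RHS](revK w) -prodgV.
by apply: eq_bigr => -[i []] _ //=; rewrite invgK.
Qed.

Lemma weval_wcomm g v w : weval g (wcomm v w) = [~ weval g v, weval g w].
Proof. by rewrite /wcomm !weval_cat !weval_winv. Qed.

Lemma eq_weval g h w : {in wvars w, g =1 h} -> weval g w = weval h w.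
Proof.
by move=> gh; apply: eq_big_seq => -[i b] /(map_f fst)/gh /= ->.
Qed.

Lemma weval1 w : weval (fun=> 1 : G) w = 1.
Proof. by rewrite /weval big1 // => l _; rewrite invg1 if_same. Qed.

Lemma wvalues1 w : wvalues G w 1.
Proof. by exists (fun=> 1); rewrite ?weval1. Qed.

Lemma wvaluesJ w x y : wvalues G w x -> wvalues G w (x ^ y).
Proof.
move=> [g _ <-]; exists (fun i => g i ^ y) => //.
rewrite /weval conjg_prod; apply: eq_bigr => -[i []] _ //=.
by rewrite conjVg.
Qed.

(** As the words share no variable, the two assignments can be glued into one. *)
Lemma wvalues_wcomm v w x y :
    (forall i, i \in wvars v -> i \notin wvars w) ->
  wvalues G v x -> wvalues G w y -> wvalues G (wcomm v w) [~ x, y].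
Proof.
move=> dvw [g _ <-] [h _ <-].
exists (fun i => if i \in wvars v then g i else h i) => //.
rewrite weval_wcomm; congr [~ _, _]; apply: eq_weval => i.
  by move=> ->.
by case: ifP => // /dvw /negP.
Qed.

Lemma wvalues_wcommP v w z :
  wvalues G (wcomm v w) z ->
  exists x y, [/\ wvalues G v x, wvalues G w y & z = [~ x, y]].
Proof.
move=> [g _ <-]; exists (weval g v), (weval g w); rewrite weval_wcomm.
by split=> //; exists g.
Qed.

End Words.

Lemma wvars_winv w : wvars (winv w) =i wvars w.
Proof.
move=> i; rewrite /wvars /winv map_rev mem_rev -map_comp.
by congr (_ \in _); apply: eq_map => -[].
Qed.

Lemma wvars_wcomm v w i :
  (i \in wvars (wcomm v w)) = (i \in wvars v) || (i \in wvars w).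
Proof.
rewrite /wcomm {1}/wvars !map_cat !mem_cat -!/(wvars _) !wvars_winv.
by case: (i \in wvars v); rewrite //= orbb.
Qed.

Lemma weval_morph (G Q : groupType) (p : G -> Q) g w :
  {morph p : x y / x * y} -> weval (p \o g) w = p (weval g w).
Proof.
move=> pM; have p1 : p 1 = 1 by apply: (mulgI (p 1)); rewrite -pM !mulg1.
have pV x : (p x)^-1 = p x^-1 by apply: mulg1_eq; rewrite -pM mulgV.
rewrite /weval (big_morph p pM p1); apply: eq_bigr => -[i []] _ //=.
Qed.

(** With 1 in place of all other variables only the letters in [x_i] survive; [p] and [n] count its
    positive and negative occurrences. They are chosen before the group, so that exponents derived
    from them are uniform. *)
Lemma weval_single i w : exists p n : nat,
  exponent_sum w i = (p%:Z - n%:Z)%R /\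
  forall (G : groupType) (x : G),
    weval (fun j => if j == i then x else 1) w = x ^+ p / x ^+ n.
Proof.
elim: w => [|[j b] w [p [n [E W]]]].
  exists 0, 0.
  by split=> [|G x]; rewrite /exponent_sum /weval !big_nil //= divgg.
have Ec : exponent_sum ((j, b) :: w) i =
    ((if j == i then (-1) ^+ b else 0) + exponent_sum w i)%R.
  by rewrite /exponent_sum big_cons /=; case: eqP => // _; rewrite add0r.
have Wc (G : groupType) (h : nat -> G) :
    weval h ((j, b) :: w) = (if b then (h j)^-1 else h j) * weval h w.
  by rewrite /weval big_cons.
have [ji|ji] := eqVneq j i; last first.
  exists p, n; split=> [|G x].
    by rewrite Ec (negPf ji) add0r.
  by rewrite Wc W (negPf ji) invg1 if_same mul1g.
case: b Ec Wc => Ec Wc; [exists p, n.+1|exists p.+1, n]; split=> [|G x].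
- by rewrite Ec ji eqxx expr1 E; lia.
- rewrite Wc W ji eqxx.
  have xC k : commute x^-1 (x ^+ k).
    by apply/commute_sym/commuteV/commute_sym/commuteX/commute_refl.
  by rewrite expgS invgM [RHS]mulgA; apply: commuteM; [|apply: commuteV].
- by rewrite Ec ji eqxx expr0 E; lia.
- by rewrite Wc W ji eqxx expgS mulgA.
Qed.

Lemma wvalues_power w : non_commutator w ->
  exists2 e : nat, 0 < e & forall (G : groupType) (x : G), wvalues G w (x ^+ e).
Proof.
move=> [i _]; have [p [n [-> W]]] := weval_single i w => pn.
have {pn}: p != n by apply: contra_notN pn => /eqP ->; rewrite subrr.
rewrite neq_ltn => /orP[lt|lt].
  exists (n - p); rewrite ?subn_gt0 // => G x.
  (* Here the exponent sum is negative, so [x^-1] is substituted. *)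
  exists (fun j => if j == i then x^-1 else 1) => //.
  rewrite W !expVgn invgK expgnFr ?(ltnW lt)//.
  by apply/commute_sym/commuteV/commuteX/commute_sym/commuteX/commute_refl.
exists (p - n); rewrite ?subn_gt0 // => G x.
by exists (fun j => if j == i then x else 1); rewrite // W expgnFr // ltnW.
Qed.

(** * Quotients of possibly infinite groups *)

Definition subgroup (G : groupType) (L : set G) :=
  [/\ L 1, forall x y, L x -> L y -> L (x * y) & forall x, L x -> L x^-1].

Definition normalized (G : groupType) (L : set G) :=
  forall x y, L x -> L (x ^ y).

Lemma quotient_group (G : groupType) (L : set G) :
    subgroup L -> normalized L ->
  exists (Q : groupType) (p : G -> Q),
    [/\ {morph p : x y / x * y}, forall q, exists g, p g = q &
        forall x y, p x = p y <-> L (x / y)].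
Proof.
move=> [L1 LM LV] LJ.
pose r x y := `[< L (x / y) >].
have rP : equiv_class_of r.
  split=> [x|x y|y x z].
  - by apply/asboolP; rewrite divgg.
  - by apply/asboolP/asboolP => /LV; rewrite invgF.
  - move=> /asboolP xy /asboolP yz; apply/asboolP.
    by rewrite -(divgKA y); apply: LM.
pose e := EquivRelPack rP.
pose Q := {eq_quot e}.
have piE x y : \pi_Q x = \pi_Q y <-> L (x / y).
  by split=> [/eqmodP/asboolP|xy]; last by apply/eqmodP/asboolP.
have reprP x : L (repr (\pi_Q x) / x) by apply/piE; rewrite reprK.
have [mul mulE] : exists mul : Q -> Q -> Q,
    forall x y, mul (\pi_Q x) (\pi_Q y) = \pi_Q (x * y).
  exists (fun a b => \pi_Q (repr a * repr b)) => x y.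
  apply/piE; rewrite invgM mulgA.
  (* The error of the product of representatives is the error at [x] times a conjugate of the error
     at [y]; normality of [L] absorbs the conjugation. *)
  have -> : repr (\pi_Q x) * repr (\pi_Q y) / y / x =
     (repr (\pi_Q x) / x) * (repr (\pi_Q y) / y) ^ x^-1.
     by rewrite conjgE invgK !mulgA mulgVK.
  by apply: LM; [|apply: LJ]; apply: reprP.
have [inv invE] : exists inv : Q -> Q,
    forall x, inv (\pi_Q x) = \pi_Q x^-1.
  exists (fun a => \pi_Q (repr a)^-1) => x; apply/piE; rewrite invgK.
  have -> : (repr (\pi_Q x))^-1 * x = ((repr (\pi_Q x) / x) ^ x)^-1.
    by rewrite conjgE mulgVK invgM invgK.
  exact/LV/LJ/reprP.
have mulA : associative mul.
  move=> a b c. by rewrite -[a]reprK -[b]reprK -[c]reprK !mulE mulgA.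
have mul1 : left_id (\pi_Q 1) mul by move=> a; rewrite -[a]reprK mulE mul1g.
have mulr1 : right_id (\pi_Q 1) mul by move=> a; rewrite -[a]reprK mulE mulg1.
have mulV : left_inverse (\pi_Q 1) inv mul.
  by move=> a; rewrite -[a]reprK invE mulE mulVg.
have mulrV : right_inverse (\pi_Q 1) inv mul.
  by move=> a; rewrite -[a]reprK invE mulE mulgV.
pose QG := HB.pack_for groupType Q (isGroup.Build Q mulA mul1 mulr1 mulV mulrV).
exists QG, (\pi_Q : G -> QG); split.
- by move=> x y; rewrite -mulE.
- by move=> q; exists (repr q); rewrite /= reprK.
- exact: piE.
Qed.

(** * The transfer into a central subgroup of finite index *)

Lemma perm_prodg (G : groupType) (s1 s2 : seq G) :
    perm_eq s1 s2 -> {in s1 &, forall x y, commute x y} ->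
  \prod_(x <- s1) x = \prod_(x <- s2) x.
Proof.
elim: s1 s2 => [|x s1 IH] s2 s12 cs.
  by move: s12; rewrite perm_sym => /perm_nilP ->.
have /path.splitPr xs2 : x \in s2 by rewrite -(perm_mem s12) mem_head.
case: xs2 s12 => a b; rewrite perm_sym perm_catC cat_cons perm_cons => ba.
have s1E : perm_eq s1 (a ++ b) by rewrite perm_sym perm_catC.
rewrite big_cons (IH _ s1E) => [|y z ys zs]; last first.
  by apply: cs; rewrite in_cons ?ys ?zs orbT.
rewrite !big_cat big_cons /= !mulgA; congr (_ * _).
rewrite big_seq; apply: commute_prod => y ya; apply: cs; first exact: mem_head.
by rewrite in_cons (perm_mem s1E) mem_cat ya orbT.
Qed.

Section Transfer.
Variables (G : groupType) (H Z : set G) (F : finType) (rho : G -> F).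
Hypotheses (sgH : subgroup H) (sgZ : subgroup Z) (ZH : forall z, Z z -> H z).
Hypothesis ZC : forall z h, Z z -> H h -> commute z h.
Hypothesis rhoP : forall h k, H h -> H k -> (rho h = rho k <-> Z (h / k)).

Lemma transfer : exists (tau : G -> G) (q : nat),
  [/\ 0 < q <= #|F|, forall h, H h -> Z (tau h),
      forall h k, H h -> H k -> tau (h * k) = tau h * tau k &
      forall z, Z z -> tau z = z ^+ q].
Proof.
have [H1 HM HV] := sgH; have [Z1 ZM ZV] := sgZ.
pose s a := xget 1 [set h | H h /\ rho h = a].
(* Only labels attained on [H] are kept, so the default 1 of [s] never stands in for a missing
   representative. *)
pose Q := [seq a <- enum F | `[< exists2 h, H h & rho h = a >]].
have QP h : H h -> rho h \in Q.
  by move=> Hh; rewrite mem_filter mem_enum andbT; apply/asboolP; exists h.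
have sP a : a \in Q -> H (s a) /\ rho (s a) = a.
  rewrite mem_filter => /andP[/asboolP[h Hh ha] _].
  by apply: (@xgetPex _ 1 [set h | H h /\ rho h = a]); exists h.
pose act a h := rho (s a * h).
have actQ a h : a \in Q -> H h -> act a h \in Q.
  by move=> /sP[Ha _] Hh; apply/QP/HM.
pose t a h := s a * h / s (act a h).
have tZ a h : a \in Q -> H h -> Z (t a h).
  move=> Qa Hh; have [Ha ra] := sP a Qa.
  have [Hb rb] := sP _ (actQ a h Qa Hh).
  by apply/(rhoP (HM _ _ Ha Hh) Hb).
have actM a g h : a \in Q -> H g -> H h -> act (act a g) h = act a (g * h).
  move=> Qa Hg Hh; have [Ha ra] := sP a Qa.
  have [Hb rb] := sP _ (actQ a g Qa Hg).
  apply/rhoP; [exact: HM|exact/HM/HM|].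
  by rewrite [s a * _]mulgA mulgKA; apply/rhoP => //; apply: HM.
have actI h : H h -> {in Q &, injective (act^~ h)}.
  move=> Hh a b Qa Qb /=; have [Ha ra] := sP a Qa; have [Hb rb] := sP b Qb.
  move=> /(rhoP (HM _ _ Ha Hh) (HM _ _ Hb Hh)); rewrite mulgKA.
  by move/rhoP; rewrite ra rb => ->.
have uQ : uniq Q by rewrite filter_uniq ?enum_uniq.
have permQ h : H h -> perm_eq [seq act a h | a <- Q] Q.
  move=> Hh; have uA : uniq [seq act a h | a <- Q].
    by rewrite map_inj_in_uniq //; apply: actI.
  apply: uniq_perm => //.
  apply: (uniq_min_size uA _ _).2; last by rewrite size_map.
  by move=> _ /mapP[a Qa ->]; apply: actQ.
exists (fun h => \prod_(a <- Q) t a h), (size Q); split.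
- apply/andP; split; last by rewrite size_filter cardE count_size.
  by have := QP 1 H1; case: (Q).
- move=> h Hh /=; rewrite big_seq.
  by apply: big_ind => [||a Qa]; [exact: Z1|exact: ZM|exact: tZ].
- move=> g h Hg Hh /=.
  (* Translation by [g] permutes the cosets; after this reindexing,
     [t a (g * h) = t a g * t (act a g) h] gives multiplicativity factor by factor. *)
  have -> : \prod_(a <- Q) t a h = \prod_(a <- Q) t (act a g) h.
    rewrite -(big_map (act^~ g) xpredT (fun a => t a h)).
    rewrite -[LHS](big_map (t^~ h) xpredT id).
    rewrite -[RHS](big_map (t^~ h) xpredT id).
    apply: perm_prodg; first by apply: perm_map; rewrite perm_sym permQ.
    move=> _ _ /mapP[a Qa ->] /mapP[b Qb ->].
    by apply: ZC; [|apply: ZH]; apply: tZ.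
  rewrite [LHS]big_seq [X in _ = _ * X]big_seq [X in _ = X * _]big_seq.
  rewrite -prodgM_commute.
    apply: eq_bigr => a Qa; rewrite /t actM // !mulgA mulgVK //.
  by move=> a b Qa Qb; apply: ZC; [|apply: ZH]; apply: tZ => //; apply: actQ.
move=> z Zz /=; have -> : \prod_(a <- Q) t a z = \prod_(a <- Q) z.
  apply: eq_big_seq => a Qa; have [Ha ra] := sP a Qa.
  have az : act a z = a.
    rewrite -[RHS]ra; apply/rhoP; [exact/HM/ZH|by []|].
    by rewrite -(ZC Zz Ha) mulgK.
  by rewrite /t az -(ZC Zz Ha) mulgK.
by rewrite big_const_seq count_predT iter_mulg_1.
Qed.

End Transfer.

(** Pigeonhole on the indices up to [#|F|]. The bound on [l] matters because it makes [l - k] divide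
    the factorial of [#|F|]. *)
Lemma nat_collision (F : finType) (f : nat -> F) :
  exists k l, [/\ k < l, l <= #|F| & f k = f l].
Proof.
pose g (i : 'I_#|F|.+1) := f i.
have /injectivePn[i [j ij gij]] : ~~ injectiveb g.
  by apply/negP => /injectiveP/leq_card; rewrite card_ord ltnn.
have := ij; rewrite neq_ltn => /orP[lt|lt]; [exists i, j|exists j, i].
  by split=> //; rewrite -ltnS.
by split=> //; rewrite -ltnS.
Qed.

(** * Dietzmann's lemma *)

(** Copies of [x] move to the front by [y * x ^+ j = x ^+ j * y ^ (x ^+ j)]; the letters passed over
    are only conjugated and stay in [X]. *)
Lemma prodg_collect (G : groupType) (X : set G) (x : G) (l : seq G) (j : nat) :
    (forall y g, X y -> X (y ^ g)) ->
    {in l, forall y, X y} -> j <= count_mem x l ->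
  exists l', [/\ {in l', forall y, X y}, (size l' + j)%N = size l &
    \prod_(y <- l) y = x ^+ j * \prod_(y <- l') y].
Proof.
move=> XJ; elim: l j => [|y l IH] j Xl /=.
  by rewrite leqn0 => /eqP ->; exists [::]; split; rewrite ?big_nil ?mulg1.
have Xl' : {in l, forall y, X y}.
  by move=> z zl; apply: Xl; rewrite in_cons zl orbT.
have [yx|_] := eqVneq y x.
  case: j => [|j].
    by move=> _; exists (y :: l); rewrite addn0 mul1g; split.
  move=> /= /(IH j Xl')[l' [Xl'' sl' pl']]; exists l'; split=> //.
    by rewrite addnS sl'.
  by rewrite big_cons pl' mulgA yx expgS.
move=> /(IH j Xl')[l' [Xl'' sl' pl']]; exists (y ^ (x ^+ j) :: l'); split.
- move=> z; rewrite in_cons => /predU1P[->|/Xl''//].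
  by apply: XJ; apply: Xl; rewrite mem_head.
- by rewrite /= addSn sl'.
- by rewrite !big_cons pl' mulgA [y * _]conjgC -mulgA.
Qed.

(** In a product of more than [#|F| * n] elements of [X] some factor occurs [n] times; collected at
    the front, these copies cancel. Hence products of bounded length already form a subgroup. [E]
    precedes [G] to make the bound uniform. *)
Lemma dietzmann (F : finType) (n : nat) : 0 < n ->
  exists E : finType, forall (G : groupType) (X : set G) (f : G -> F),
    X 1 -> normalized X -> (forall x, X x -> x ^+ n = 1) ->
    (forall x y, X x -> X y -> f x = f y -> x = y) ->
  exists b : E -> G, subgroup (range b) /\ (forall x, X x -> range b x).
Proof.
move=> n0; pose k := (#|F| * n)%N; exists {ffun 'I_k -> F} => G X f X1 XJ Xn fI.
(* [s] inverts [f] on [X]; the default 1 is itself in [X], so [s] maps all of [F] into [X]. *)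
pose s a := xget 1 [set x | X x /\ f x = a].
have sX a : X (s a) by rewrite /s; case: xgetP => [x -> []|].
have sf x : X x -> s (f x) = x.
  move=> Xx; rewrite /s; case: xgetP => [y -> [Xy /fI]|/(_ x)]; last by case.
  exact.
pose b (t : {ffun 'I_k -> F}) := \prod_(i < k) s (t i).
have short l : {in l, forall y, X y} -> exists l',
    [/\ {in l', forall y, X y}, size l' <= k &
      \prod_(y <- l) y = \prod_(y <- l') y].
  have [m] := ubnP (size l); elim: m l => // m IH l; rewrite ltnS => lm Xl.
  have [|lk] := leqP (size l) k; first by exists l.
  have [a na] : exists a, n <= count (fun y => f y == a) l.
    apply/not_existsP => Na; move: lk; rewrite ltnNge => /negP; apply.
    rewrite -sum1_size (partition_big f predT) //= /k -sum_nat_const.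
    apply: leq_sum => a _; rewrite sum1_count.
    by have /negP := Na a; rewrite -ltnNge => /ltnW.
  have /hasP[x xl /eqP fx] : has (fun y => f y == a) l.
    by rewrite has_count (leq_trans n0).
  have nx : n <= count_mem x l.
    rewrite (leq_trans na) // (@eq_in_count _ _ (pred1 x)) // => y yl /=.
    by apply/eqP/eqP => [|->//]; rewrite -fx; apply: fI; apply: Xl.
  have [l' [Xl' sl' ->]] := prodg_collect XJ Xl nx.
  rewrite Xn ?mul1g; last exact: Xl.
  by apply: IH => //; rewrite (leq_trans _ lm) // -sl' -[ltnLHS]addn0 ltn_add2l.
have rangeP x : range b x <->
    exists2 l, {in l, forall y, X y} & x = \prod_(y <- l) y.
  split=> [[t _ <-]|[l /short[l' [Xl' lk' ->]] ->]].
    exists [seq s (t i) | i <- index_enum 'I_k].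
      by move=> _ /mapP[i _ ->].
    by rewrite big_map.
  (* Padding with 1 brings the length to exactly [k]. *)
  pose l2 := l' ++ nseq (k - size l') 1.
  have sl2 : size l2 = k by rewrite size_cat size_nseq subnKC.
  have Xl2 : {in l2, forall y, X y}.
    by move=> y; rewrite mem_cat => /orP[/Xl'//|/nseqP[->]].
  have -> : \prod_(y <- l') y = \prod_(y <- l2) y.
    by rewrite big_cat /= [X in _ * X]big_nseq iter_mulg_1 expg1n mulg1.
  exists [ffun i : 'I_k => f (nth 1 l2 i)] => //.
  rewrite (big_nth 1) sl2 big_mkord; apply: eq_bigr => i _.
  by rewrite ffunE sf //; apply/Xl2/mem_nth; rewrite sl2.
exists b; split=> [|x Xx]; last first.
  by apply/rangeP; exists [:: x]; rewrite ?big_seq1 // => y /predU1P[->|].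
split.
- by apply/rangeP; exists [::]; rewrite ?big_nil.
- move=> x y /rangeP[lx Xlx ->] /rangeP[ly Xly ->]; apply/rangeP.
  exists (lx ++ ly); last by rewrite big_cat.
  by move=> z; rewrite mem_cat => /orP[/Xlx|/Xly].
- move=> x /rangeP[l Xl ->]; apply/rangeP.
  elim: l Xl => [|y l IH] Xl; first by exists [::] => //; rewrite big_nil invg1.
  have [z zl|l' Xl' E] := IH; first by apply: Xl; rewrite in_cons zl orbT.
  (* The inverse of [y] is [y ^+ n.-1], again a product of elements of [X]. *)
  exists (l' ++ nseq n.-1 y).
    move=> z; rewrite mem_cat => /orP[/Xl'//|/nseqP[-> _]].
    by apply: Xl; rewrite mem_head.
  rewrite big_cons invgM E big_cat /= [X in _ = _ * X]big_nseq iter_mulg_1.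
  congr (_ * _); apply: mulg1_eq; rewrite -expgS prednK //.
  by apply/Xn/Xl; rewrite mem_head.
Qed.

(** * The commutator step *)

Section Centralizers.
Variable G : groupType.
Implicit Types A L : set G.

Definition centralizer A : set G := [set g | forall a, A a -> commute a g].

Lemma subgroup_centralizer A : subgroup (centralizer A).
Proof.
split=> [a _|g h Cg Ch a Aa|g Cg a Aa]; first exact: commute1.
- by apply: commuteM; [apply: Cg|apply: Ch].
- by apply: commuteV; apply: Cg.
Qed.

Lemma normalized_centralizer A : normalized A -> normalized (centralizer A).
Proof.
move=> AJ g y Cg a Aa; rewrite -(conjgKV y a) /commute -!conjMg.
by congr (_ ^ _); apply/Cg/AJ.
Qed.

Lemma commMgJ (x y z : G) : [~ x * y, z] = [~ x, z] ^ y * [~ y, z].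
Proof. by rewrite /commg /conjg !gnorm. Qed.

Lemma commgMJ (x y z : G) : [~ x, y * z] = [~ x, z] * [~ x, y] ^ z.
Proof. by rewrite /commg /conjg !gnorm. Qed.

Lemma commVg (x z : G) : [~ x^-1, z] = ([~ x, z]^-1) ^ x^-1.
Proof. by rewrite /commg /conjg !gnorm. Qed.

Lemma normalized_conjg L x y : normalized L -> L (x ^ y) -> L x.
Proof. by move=> LJ /(LJ _ y^-1); rewrite conjgK. Qed.

Lemma conjg_commuteP (x y : G) : x ^ y = x <-> commute x y.
Proof. by split=> [/conjg_fixP/commgP|/commgP/conjg_fixP]. Qed.

End Centralizers.

Section CommutatorStep.
Variables (G : groupType) (F : finType) (f : G -> F) (e : nat).
Variables X Y : set G.
Hypotheses (XJ : normalized X) (YJ : normalized Y).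
Hypothesis Ye : forall g, Y (g ^+ e).

Let W : set G := [set w | exists x y, [/\ X x, Y y & w = [~ x, y]]].

Hypothesis fI : forall v w, W v -> W w -> f v = f w -> v = w.

Let N := (e * (#|F|)`!)%N.

Let WJ : normalized W.
Proof.
move=> _ z [x [y [Xx Yy ->]]]; exists (x ^ z), (y ^ z).
by split; [apply: XJ|apply: YJ|rewrite conjRg].
Qed.

(** Two of the elements [[~ x, g ^+ (e * k)]] of [W] coincide, so [x] commutes with
    [g ^+ (e * (l - k))], whose exponent divides [N]. *)
Let X_commute_power x g : X x -> commute x (g ^+ N).
Proof.
move=> Xx; have [k [l [kl lF Efkl]]] :=
  nat_collision (fun k => f [~ x, g ^+ (e * k)]).
have Wk j : W [~ x, g ^+ (e * j)].
  by exists x, (g ^+ (e * j)); split=> //; rewrite mulnC expgnA.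
have cx : commute x (g ^+ (e * (l - k))).
  have /mulgI Exkl := fI (Wk k) (Wk l) Efkl.
  apply/conjg_commuteP.
  rewrite mulnBr expgnFr; last by rewrite leq_mul2l ltnW ?orbT.
  by rewrite conjgM -Exkl conjgK.
have /dvdnP[j Ej] : (l - k) %| (#|F|)`!.
  by rewrite dvdn_fact // subn_gt0 kl (leq_trans (leq_subr _ _)).
by rewrite /N Ej [(j * _)%N]mulnC mulnA expgnA; apply: commuteX.
Qed.

Let K := centralizer W.
Let H := centralizer K.
(** As [W] lies in [H], this is the centre of [H], the target of the transfer below. *)
Let Z : set G := [set z | H z /\ K z].
Let T : set G := [set t | Z t /\ t ^+ N = 1].
Let L : set G := [set g | forall y, Y y -> T [~ g, y]].

Let sgK : subgroup K. Proof. exact: subgroup_centralizer. Qed.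
Let sgH : subgroup H. Proof. exact: subgroup_centralizer. Qed.
Let KJ : normalized K. Proof. exact/normalized_centralizer/WJ. Qed.
Let HJ : normalized H. Proof. exact/normalized_centralizer/KJ. Qed.

Let WH w : W w -> H w.
Proof. by move=> Ww k Kk; apply/commute_sym/Kk. Qed.

Let sgZ : subgroup Z.
Proof.
have [H1 HM HV] := sgH; have [K1 KM KV] := sgK.
split=> [|x y [Hx Kx] [Hy Ky]|x [Hx Kx]].
- by split.
- by split; [apply: HM|apply: KM].
- by split; [apply: HV|apply: KV].
Qed.

Let ZJ : normalized Z.
Proof. by move=> x y [Hx Kx]; split; [apply: HJ|apply: KJ]. Qed.

Let ZC z h : Z z -> H h -> commute z h.
Proof. by move=> [_ Kz] Hh; apply: Hh. Qed.

Let sgT : subgroup T.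
Proof.
have [Z1 ZM ZV] := sgZ; split=> [|x y [Zx xN] [Zy yN]|x [Zx xN]].
- by split; rewrite ?expg1n.
- split; first exact: ZM.
  by rewrite expgMn ?xN ?yN ?mulg1 //; apply: ZC => //; case: Zy.
- by split; [apply: ZV|rewrite expVgn xN invg1].
Qed.

Let TJ : normalized T.
Proof. by move=> x y [Zx xN]; split; [apply: ZJ|rewrite -conjXg xN conj1g]. Qed.

Let sgL : subgroup L.
Proof.
have [T1 TM TV] := sgT; split=> [y _|g h Lg Lh y Yy|g Lg y Yy].
- by rewrite comm1g.
- by rewrite commMgJ; apply: TM; [apply/TJ/Lg|apply: Lh].
- by rewrite commVg; apply/TJ/TV/Lg.
Qed.

Let LJ : normalized L.
Proof.
move=> g h Lg y Yy; rewrite -(conjgKV h y) -conjRg.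
exact/TJ/Lg/YJ.
Qed.

Let s a := xget 1 [set w | W w /\ f w = a].

Let sf w : W w -> s (f w) = w.
Proof.
move=> Ww; rewrite /s; case: xgetP => [v -> [Wv /fI]|/(_ w)]; last by case.
exact.
Qed.

(** The conjugation action of [g] on [W], read on labels. Its kernel is [K], so [rho] labels the
    cosets of [K]. Off the labels of [W], [s] is 1 and the entry does not depend on [g]. *)
Let rho g : {ffun F -> F} := [ffun a => f (s a ^ g)].

Let rhoP g h : rho g = rho h <-> K (g / h).
Proof.
split=> [/ffunP E w Ww|Kgh].
  have := E (f w); rewrite !ffunE sf // => /(fI (WJ _ Ww) (WJ _ Ww)) Ew.
  by apply/conjg_commuteP; rewrite conjgM Ew conjgK.
apply/ffunP => a; rewrite !ffunE; congr f.
rewrite -[g](mulgVK h) conjgM; congr (_ ^ h).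
rewrite /s; case: xgetP => [w _ [Ww _]|_]; last by rewrite conj1g.
by apply/conjg_commuteP/Kgh.
Qed.

(* If [y' = k y] with [k] in [K], then [[x, k]] lies in the abelian group [Z]
   and commutes with [k], so that [[x, k] ^+ N = [x, k ^+ N] = 1]. *)
Let rho_comm x y y' : X x -> Y y -> Y y' -> rho y' = rho y ->
  T ([~ x, y'] / [~ x, y]).
Proof.
move=> Xx Yy Yy' /rhoP; set k := y' / y => Kk.
have [H1 HM HV] := sgH; have [K1 KM KV] := sgK.
have -> : [~ x, y'] = [~ x, y] * [~ x, k] ^ y by rewrite -commgMJ mulgVK.
set c := [~ x, y]; set d := [~ x, k].
have Wc : W c by exists x, y.
have Hd : H d.
  apply: (@normalized_conjg _ _ _ y HJ).
  have -> : d ^ y = c^-1 * [~ x, y'].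
    by rewrite -(mulgVK y y') commgMJ mulKg.
  by apply: HM; [apply/HV/WH|apply: WH; exists x, y'].
have dE : d = (k^-1) ^ x * k by rewrite /d commgEr.
have Kd : K d by rewrite dE; apply: KM => //; apply/KJ/KV.
have -> : c * d ^ y / c = d ^ (y / c).
  by rewrite conjgM [_ ^ c^-1]conjgE invgK -mulgA.
apply: TJ; split=> //.
have dk : commute d k by apply/commute_sym/Hd.
have kxE : (k^-1) ^ x = d / k by rewrite dE mulgK.
have kxk : commute ((k^-1) ^ x) k.
  rewrite kxE; apply/commute_sym/commuteM; first exact/commute_sym.
  exact/commuteV/commute_refl.
rewrite dE expgMn //.
rewrite -conjXg expVgn; have /conjg_commuteP -> : commute (k ^- N) x.
  by apply/commute_sym/commuteV/X_commute_power.
by rewrite mulVg.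
Qed.

(** [phi x] records the labels of [[~ x, y]] for one [y] in [Y] from each coset of [K] that meets
    [Y]; by [rho_comm] this determines all [[~ x, y]] modulo [T], hence [x] modulo [L]. The exponent
    [n] is left free, to be supplied by induction. *)
Lemma commutator_step :
  exists (L : set G) (phi : G -> {ffun {ffun F -> F} -> F}),
  [/\ subgroup L, normalized L,
      forall x x', X x -> X x' -> phi x = phi x' -> L (x / x') &
      forall n x y, 0 < n -> L (x ^+ n) -> X x -> Y y ->
        [~ x, y] ^+ (N * (n * (#|{ffun F -> F}|)`!)) = 1].
Proof.
have [T1 TM TV] := sgT.
pose r a := xget 1 [set y | Y y /\ rho y = a].
exists L, (fun x => [ffun a => f [~ x, r a]]); split=> //.
  move=> x x' Xx Xx' /ffunP E y Yy.
  have [Yr rE] : Y (r (rho y)) /\ rho (r (rho y)) = rho y.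
    by apply: (@xgetPex _ 1 [set z | Y z /\ rho z = rho y]); exists y.
  have Er : [~ x, r (rho y)] = [~ x', r (rho y)].
    have := E (rho y); rewrite !ffunE.
    by apply: fI; [exists x|exists x']; exists (r (rho y)).
  have -> : [~ x / x', y] = ([~ x, y] / [~ x', y]) ^ x'^-1.
    by rewrite commMgJ commVg -conjMg.
  apply: TJ; rewrite -(mulgVK [~ x, r (rho y)] [~ x, y]) {2}Er -mulgA.
  apply: TM; first exact: rho_comm.
  by rewrite -invgF; apply/TV/rho_comm.
move=> n x y n0 Lx Xx Yy; set c := [~ x, y].
have Wc : W c by exists x, y.
have [H1 HM HV] := sgH.
(* On [H] the cosets of [Z] are those of [K], so [rho] labels them too and bounds the index [q]. *)
have [tau [q [/andP[q0 qF] tauZ tauM tauE]]] : exists (tau : G -> G) (q : nat),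
  [/\ 0 < q <= #|{ffun F -> F}|, forall h, H h -> Z (tau h),
      forall h k, H h -> H k -> tau (h * k) = tau h * tau k &
      forall z, Z z -> tau z = z ^+ q].
  apply: (@transfer G H Z _ rho) => // [z []//|h k Hh Hk].
  split=> [/rhoP Khk|[_ /rhoP]//]; split=> //.
  by apply: HM => //; apply: HV.
have tauX h j : H h -> tau (h ^+ j) = tau h ^+ j.
  move=> Hh; elim: j => [|j IH]; first by rewrite tauE ?expg1n //; case: sgZ.
  have Hhj : H (h ^+ j) by elim: (j) => [|i IHi]; rewrite ?expgS //; apply: HM.
  by rewrite !expgS tauM // IH.
have cN x' : X x' -> commute x' (c ^+ N) by move=> Xx'; apply: X_commute_power.
have HX h j : H h -> H (h ^+ j).
  by move=> Hh; elim: j => [|i IHi]; rewrite ?expgS //; apply: HM.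
(* An [N]-th power commutes with [X], hence with each [[~ x', y']], a product of [x'^-1] and the
   element [x' ^ y'] of [X]. *)
have ZcN : Z (c ^+ N).
  split; first exact/HX/WH.
  move=> _ [x' [y' [Xx' Yy' ->]]]; apply: commute_sym; rewrite commgEl.
  apply: commuteM; first by apply/commuteV/commute_sym/cN.
  by apply/commute_sym/cN/XJ.
(* This is [[~ x ^+ j, y]]; by [PS] it is the product of the [c ^ (x ^+ i)] for [i < j], in
   descending order. *)
pose P j := x ^- j * (x ^ y) ^+ j.
have PS j : P j.+1 = c ^ (x ^+ j) * P j.
  have E a v w : (x * a)^-1 * (w * v) = (x^-1 * w) ^ a * (a^-1 * v).
    by rewrite conjgE invgM -!mulgA mulVKg.
  by rewrite /P !expgS E.
have Pn : T (P n) by rewrite /P -conjXg; apply: Lx.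
(* Each factor contributes [c ^+ (N * q)]: its [N]-th power is [c ^+ N], as [x] commutes with it,
   and [tau] raises this element of [Z] to the power [q]. *)
have {}PT j : H (P j) /\ tau (P j) ^+ N = c ^+ (N * q * j).
  elim: j => [|j [HP tP]].
    by rewrite /P invg1 mulg1 tauE ?expg1n ?muln0 //; case: sgZ.
  have HcJ : H (c ^ (x ^+ j)) by apply/HJ/WH.
  rewrite PS; split; first exact: HM.
  rewrite tauM // expgMn; last by apply: ZC; [apply: tauZ|case: (tauZ _ HP)].
  rewrite tP -tauX // -conjXg.
  have -> : (c ^+ N) ^ (x ^+ j) = c ^+ N.
    exact/conjg_commuteP/commuteX/commute_sym/cN.
  by rewrite tauE // -expgnA -expgnDr -mulnS.
have [_] := PT n.
have [ZP PN] := Pn.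
(* [P n] is in [T], so [tau (P n)] is its [q]-th power and has trivial [N]-th power; thus
   [c ^+ (N * q * n) = 1]. *)
rewrite tauE // expgnAC PN expg1n => E.
have /dvdnP[i ->] : q %| (#|{ffun F -> F}|)`! by rewrite dvdn_fact // q0.
have -> : (N * (n * (i * q)) = N * q * n * i)%N by lia.
by rewrite expgnA -E expg1n.
Qed.

End CommutatorStep.

(** * Bounded exponent of the values *)

(** The map [f] into [F] expresses that there are at most [#|F|] values. All abstract groups are
    allowed, so that the induction can pass to the quotient by [L] without a topology. *)
Definition bounded_exponent (w : word) := forall F : finType,
  exists2 n, 0 < n & forall (G : groupType) (f : G -> F),
    (forall x y, wvalues G w x -> wvalues G w y -> f x = f y -> x = y) ->
  forall x, wvalues G w x -> x ^+ n = 1.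

(** The powers [x ^+ (e * k)] are all values, so two of them coincide. *)
Lemma bounded_exponent_non_commutator u :
  non_commutator u -> bounded_exponent u.
Proof.
move=> /wvalues_power[e e0 ue] F; exists (e * (#|F|)`!)%N.
  by rewrite muln_gt0 e0 fact_gt0.
move=> G f fI x _.
have [k [l [kl lF Efkl]]] := nat_collision (fun k => f (x ^+ (e * k))).
have uk j : wvalues G u (x ^+ (e * j)) by rewrite mulnC expgnA.
have x1 : x ^+ (e * (l - k)) = 1.
  rewrite mulnBr expgnFr; last by rewrite leq_mul2l ltnW ?orbT.
  by rewrite (fI _ _ (uk k) (uk l) Efkl) divgg.
have /dvdnP[j ->] : (l - k) %| (#|F|)`!.
  by rewrite dvdn_fact // subn_gt0 kl (leq_trans (leq_subr _ _)).
by rewrite [(j * _)%N]mulnC mulnA expgnA x1 expg1n.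
Qed.

Lemma bounded_exponent_wcomm v u :
    (forall i, i \in wvars v -> i \notin wvars u) ->
  bounded_exponent v -> non_commutator u -> bounded_exponent (wcomm v u).
Proof.
move=> dvu bv /wvalues_power[e e0 ue] F.
(* This type is the codomain of [phi], which separates the [v]-values modulo [L]. *)
have [n n0 vn] := bv {ffun {ffun F -> F} -> F}.
exists (e * (#|F|)`! * (n * (#|{ffun F -> F}|)`!))%N.
  by rewrite !muln_gt0 e0 n0 !fact_gt0.
move=> G f fI z /wvalues_wcommP[x [y [vx uy ->]]].
have fW a b : (exists x y, [/\ wvalues G v x, wvalues G u y & a = [~ x, y]]) ->
    (exists x y, [/\ wvalues G v x, wvalues G u y & b = [~ x, y]]) ->
    f a = f b -> a = b.
  by move=> [xa [ya [vxa uya ->]]] [xb [yb [vxb uyb ->]]]; apply: fI;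
    apply: wvalues_wcomm.
have [L [phi [sgL LJ phiI Lorder]]] :=
  commutator_step (@wvaluesJ G v) (@wvaluesJ G u) (ue G) fW.
apply: Lorder => //.
have [Q [p [pM p_surj pP]]] := quotient_group sgL LJ.
have pval (g : nat -> G) w : weval (p \o g) w = p (weval g w).
  exact: weval_morph.
(* A value in the quotient lifts to a value in [G] by lifting the assignment. *)
have liftv q : wvalues Q v q -> exists2 x, wvalues G v x & p x = q.
  move=> [h _ <-]; have [g gh] := choice (fun i => p_surj (h i)).
  exists (weval g v); first by exists g.
  by rewrite -pval; apply: eq_weval => i _ /=.
pose lift q := xget 1 [set x | wvalues G v x /\ p x = q].
have liftP q : wvalues Q v q -> wvalues G v (lift q) /\ p (lift q) = q.
  move=> /liftv[x' vx' <-].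
  apply: (@xgetPex _ 1 [set a | wvalues G v a /\ p a = p x']).
  by exists x'.
have px1 : p x ^+ n = 1.
  apply: (vn Q (phi \o lift)); last first.
    by case: vx => g _ <-; exists (p \o g).
  move=> a b /liftP[va pa] /liftP[vb pb] /= /(phiI _ _ va vb)/pP.
  by rewrite pa pb.
have p1 : p 1 = 1 by apply: (mulgI (p 1)); rewrite -pM !mulg1.
have pX j : p (x ^+ j) = p x ^+ j by elim: j => // j IH; rewrite !expgS pM IH.
by rewrite -[x ^+ n]divg1; apply/pP; rewrite pX px1 p1.
Qed.

Lemma wvars_wcomms us i :
  i \in wvars (wcomms us) -> exists2 u, u \in us & i \in wvars u.
Proof.
case: us => [//|u us] /=; elim: us u => [|v us IH] u /=.
  by exists u; rewrite ?mem_head.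
move=> /IH[w]; rewrite in_cons => /predU1P[->|wus]; last first.
  by exists w; rewrite // !in_cons wus !orbT.
rewrite wvars_wcomm => /orP[iu|iv]; [exists u|exists v] => //.
  exact: mem_head.
by rewrite !in_cons eqxx orbT.
Qed.

Lemma bounded_exponent_wcomms (us : seq word) : us != [::] ->
  {in us, forall u, non_commutator u} ->
  pairwise (fun v w => ~~ has (mem (wvars v)) (wvars w)) us ->
  bounded_exponent (wcomms us).
Proof.
elim/last_ind: us => // us u IH _ ncu; rewrite pairwise_rcons.
move=> /andP[/allP du dus].
have unc : non_commutator u by apply: ncu; rewrite mem_rcons mem_head.
have [->|us0] := eqVneq us [::]; first exact: bounded_exponent_non_commutator.
have -> : wcomms (rcons us u) = wcomm (wcomms us) u.
  by case: us us0 {IH ncu du dus} => // v us _; rewrite /= foldl_rcons.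
apply: bounded_exponent_wcomm => //; last first.
  by apply: IH => // v vus; apply: ncu; rewrite mem_rcons in_cons vus orbT.
move=> i /wvars_wcomms[v /du/= dvu iv]; apply: contraNN dvu => iu.
by apply/hasP; exists i.
Qed.

(** Dietzmann's lemma encloses the values in a finite subgroup of bounded order. Being finite, it is
    closed in a Hausdorff space, so it contains the verbal subgroup. *)
Lemma boundedly_concise_bounded_exponent w :
  bounded_exponent w -> boundedly_concise w.
Proof.
move=> bw m; have [n n0 wn] := bw 'I_m.+1.
have [E bE] := dietzmann 'I_m.+1 n0; exists #|E| => G.
move=> /pcard_leP[f].
(* The successor in ['I_m.+1] keeps the type inhabited, as [inord] requires. *)
pose g (x : G) : 'I_m.+1 := inord (f x).
have gI x y : wvalues G w x -> wvalues G w y -> g x = g y -> x = y.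
  move=> wx wy gxy; apply: (@inj _ _ _ f); rewrite ?inE //.
  have fm z : wvalues G w z -> f z < m.+1.
    by move=> wz; apply: ltnW; apply: (@funS _ _ _ _ f).
  by have := congr1 val gxy; rewrite /g /= !inordK //; apply: fm.
have [b [[b1 bM bV] bw']] :=
  bE G _ g (wvalues1 G w) (@wvaluesJ G w) (wn G g gI) gI.
have cardb : (range b #<= `I_#|E|)%card.
  have sb : (range b `<=` range (b \o (enum_val : 'I_#|E| -> E)))%classic.
    by move=> _ [t _ <-]; exists (enum_rank t); rewrite //= enum_rankK.
  apply: card_le_trans (subset_card_le sb) _.
  by rewrite (card_le_eqr card_II) card_image_le.
apply: card_le_trans cardb; apply: subset_card_le.
apply: smallest_sub => //; split; last first.
  split; first by rewrite inE.
  move=> x y; rewrite !inE => bx by'.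
  exact/bM/bV.
move: (range b) (finite_image b (finite_finset (X := setT))).
apply/accessible_finite_set_closed/hausdorff_accessible.
exact: profinite_hausdorff.
Qed.

Theorem corollary1p5 (s : nat) (u : s.-tuple word) :
  0 < s ->
  (forall i : 'I_s, non_commutator (tnth u i)) ->
  (forall i j : 'I_s, i != j ->
     forall x : nat, x \in wvars (tnth u i) -> x \notin wvars (tnth u j)) ->
  boundedly_concise (wcomms u).
Proof.
move=> s0 ncu du.
apply/boundedly_concise_bounded_exponent/bounded_exponent_wcomms.
- by rewrite -size_eq0 size_tuple -lt0n.
- by move=> _ /tnthP[i ->].
apply/(pairwiseP [::]) => i j; rewrite !inE size_tuple => iS jS ij.
have := du (Ordinal iS) (Ordinal jS); rewrite !(tnth_nth [::]) /= => dij.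
apply/hasPn => x; apply: contraTN => /=; apply: dij.
by rewrite -val_eqE /= ltn_eqF.
Qed.
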